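(* Let $p$ be a prime with $p\equiv 7\pmod{12}$, or $p\in\{37,61,73,109,157,181,229,277\}$. Then for every $u\equiv 8,16\pmod{24}$ there exists a 2-D $(u\times 2p,4,2)$-OOC with exactly $J^*(u\times 2p)=\left\lfloor\frac{u}{4}\left(\left\lfloor\frac{2up-1}{3}\left\lfloor\frac{2up-2}{2}\right\rfloor\right\rfloor-1\right)\right\rfloor$ codewords.
   Context: A 2-D $(u\times v,4,2)$-OOC is a family $\mathcal C$ of $u\times v$ $(0,1)$-matrices of Hamming weight $4$ such that for all $A=(a_{ij}),B=(b_{ij})\in\mathcal C$ and integers $r$ with $A\ne B$ or $r\not\equiv0\pmod v$, $\sum_{i,j}a_{ij}b_{i,j+r}\le 2$ (column indices mod $v$). *)

(* Defs.v *)
From HB Require Import structures.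
From mathcomp Require Import all_boot all_order all_algebra.
Set Implicit Arguments. Unset Strict Implicit. Unset Printing Implicit Defensive.
Import Order.TTheory GRing.Theory Num.Theory.


Definition hweight (u v : nat) (A : 'M[bool]_(u, v)) : nat :=
  \sum_(i < u) \sum_(j < v) (A i j : nat).

Definition corr (u v : nat) (A B : 'M[bool]_(u, v)) (r : int) : nat :=
  \sum_(i < u) \sum_(j < v)
     \sum_(k < v | ((Posz k == ((Posz j + r) %% Posz v)%Z))) ((A i j && B i k) : nat).

Definition is_OOC_4_2 (u v : nat) (C : {set 'M[bool]_(u, v)}) : Prop :=
  (forall A, A \in C -> hweight A = 4) /\
  (forall A B (r : int), A \in C -> B \in C ->
     (A != B \/ ((r %% Posz v)%Z != 0%Z)) -> corr A B r <= 2).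

Definition Jstar (u v : nat) : nat :=
  (u * (((u * v - 1) * ((u * v - 2) %/ 2)) %/ 3 - 1)) %/ 4.

(* Main.v *)
Require Import Defs.
From HB Require Import structures.
From mathcomp Require Import all_boot all_order all_algebra.
From mathcomp Require Import zify.
Set Implicit Arguments. Unset Strict Implicit. Unset Printing Implicit Defensive.
Import GRing.Theory.

(** A code of size [Jstar u (2p)] is a transversal of the full orbits of a Steiner
quadruple system on [u * 2p] points which is invariant under a free action of the
cyclic group of order [2p] and has exactly [u * 2p / 4] blocks of nontrivial stabiliser.

Such a system is obtained by doubling: from a quadruple system on [T] and a
one-factorization of the complete graph on [T] whose colours carry an involution with a
single fixed colour, one gets a quadruple system on [T * bool] (the blocks on each copy of
[T], and [{a, b}] on one copy with [{c, d}] on the other when the colours of the two edges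
correspond).  The only blocks fixed by exchanging the two copies are [{a, b}] together
with [{a, b}], for the edges of the fixed colour, so there are [#|T| / 2] of them.  Hence it
suffices to have a quadruple system on [T] with a free action of [Z_p], and doublings also
supply the powers of 2 in [#|T|].

It remains to treat [#|T| = 4 * N], with [N] prime to 6, for which there is a [Z_N]-invariant
quadruple system on four copies of [Z_N].  Its generic blocks are given by linear equations;
the degenerate solutions, and finitely many one-parameter families of generic blocks, are
replaced by the families
[{(i, m - d), (i, m + d), (j, m), (j', m)}] and
[{(i, t), (i, t + 3d), (i', t + 2d), (k, t or t + 3d)}].
All coefficients which have to be invertible are of the form [2^a 3^b]. *)

(** * Quadruple systems and doubling *)

(* [q a b c] is the fourth point of the block through three distinct points. *)
Record quad_law (T : eqType) (q : T -> T -> T -> T) : Prop := QuadLaw {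
  quadCA : forall a b c, q a b c = q b a c;
  quadAC : forall a b c, q a b c = q a c b;
  quad_neq : forall a b c, a != b -> a != c -> b != c -> q a b c != c;
  quadK : forall a b c, a != b -> a != c -> b != c -> q a b (q a b c) = c }.

(* [phi a b c] is the other end of the edge through [c] whose colour corresponds to the colour
   of the edge [{a, b}]; [par_self] says that the fixed colour is a perfect matching. *)
Record parallel_law (T : eqType) (phi : T -> T -> T -> T) : Prop := ParallelLaw {
  parC : forall a b c, phi a b c = phi b a c;
  par_neq : forall a b c, a != b -> phi a b c != c;
  parK : forall a b c, a != b -> phi a b (phi a b c) = c;
  par_exch : forall a b c, a != b -> phi c (phi a b c) a = b;
  par_self : forall a, exists2 b, a != b & forall c, a != c -> (phi a c a == c) = (c == b) }.

(* Colours the edges between two copies of [T]: [psi a b c], in the second copy, is the other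
   end of the edge at [c] corresponding to the edge from [a] to [b]. *)
Record latin_law (T : eqType) (psi : T -> T -> T -> T) : Prop := LatinLaw {
  latinK : forall a b c, psi b a (psi a b c) = c;
  latin_exch : forall a b c, psi c (psi a b c) a = b;
  latin_neq : forall a b, psi a b a != b }.

Definition equivariant (T : Type) (g : T -> T) (f : T -> T -> T -> T) : Prop :=
  forall a b c, f (g a) (g b) (g c) = g (f a b c).

Section Doubling.
Variables (T : eqType) (q phi psi : T -> T -> T -> T).
Hypotheses (qP : quad_law q) (phiP : parallel_law phi) (psiP : latin_law psi).

Definition dquad (a b c : T * bool) : T * bool :=
  if a.2 == b.2 then (if b.2 == c.2 then q a.1 b.1 c.1 else phi a.1 b.1 c.1, c.2)
  else if a.2 == c.2 then (phi a.1 c.1 b.1, b.2) else (phi b.1 c.1 a.1, a.2).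

Definition dpar (a b c : T * bool) : T * bool :=
  if a.2 == b.2 then (phi a.1 b.1 c.1, c.2)
  else (if a.2 == c.2 then psi a.1 b.1 c.1 else psi b.1 a.1 c.1, ~~ c.2).

Definition dlatin (a b c : T * bool) : T * bool :=
  (psi a.1 b.1 c.1, a.2 (+) b.2 (+) c.2).

Lemma dquadP : quad_law dquad.
Proof.
case: qP phiP => qCA qAC qN qK [pC pN pK pX _]; rewrite /dquad.
split.
- by move=> [a e] [b f] [c g] /=; case: e f g => [] [] [] //=; rewrite 1?qCA 1?pC.
- by move=> [a e] [b f] [c g] /=; case: e f g => [] [] [] //=; rewrite 1?qAC 1?pC.
- move=> [a e] [b f] [c g] /=; rewrite !xpair_eqE.
  by case: e f g => [] [] [] //=; rewrite ?andbT ?andbF => ab ac bc;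
  rewrite xpair_eqE ?andbT ?andbF ?qN ?pN.
- move=> [a e] [b f] [c g] /=; rewrite !xpair_eqE.
  by case: e f g => [] [] [] //=; rewrite ?andbT ?andbF => ab ac bc;
  rewrite ?qK ?pK ?pX ?(pC _ _ b) ?pX.
Qed.

(** By [latin_neq] no edge between the two copies has a fixed colour, so [par_self] is inherited
    from [phi] on each copy. *)
Lemma dparP : parallel_law dpar.
Proof.
case: phiP psiP => pC pN pK pX pS [lK lX lN]; rewrite /dpar; split.
- by move=> [a e] [b f] [c g] /=; case: e f g => [] [] [] //=; rewrite 1?pC.
- move=> [a e] [b f] [c g] /=; rewrite !xpair_eqE.
  by case: e f g => [] [] [] //=; rewrite ?andbT ?andbF => ab; rewrite xpair_eqE ?andbT ?andbF ?pN.
- move=> [a e] [b f] [c g] /=; rewrite !xpair_eqE.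
  by case: e f g => [] [] [] //=; rewrite ?andbT ?andbF => ab; rewrite ?pK ?lK.
- have lX' a b c : psi (psi a b c) c b = a by rewrite -{2}(lX a b c) lK.
  move=> [a e] [b f] [c g] /=; rewrite !xpair_eqE.
  by case: e f g => [] [] [] //=; rewrite ?andbT ?andbF => ab; rewrite ?pX ?lX ?lX'.
- move=> [a e]; have [b ab bP] := pS a; exists (b, e); first by rewrite xpair_eqE eqxx andbT.
  move=> [c f] /=; have [<-|ef] := eqVneq e f.
    by rewrite !xpair_eqE !eqxx !andbT => /bP.
  by rewrite eqxx !xpair_eqE (negPf (lN a c)) [f == e]eq_sym (negPf ef) !andbF.
Qed.

Lemma dlatinP : latin_law dlatin.
Proof.
case: psiP => lK lX lN; rewrite /dlatin; split.
- by move=> [a e] [b f] [c g]; rewrite /= lK; case: e f g => [] [] [].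
- by move=> [a e] [b f] [c g]; rewrite /= lX; case: e f g => [] [] [].
- by move=> [a e] [b f]; rewrite xpair_eqE /= (negPf (lN a b)).
Qed.

Section Equivariance.
Variable g : T -> T.
Hypotheses (qg : equivariant g q) (phig : equivariant g phi) (psig : equivariant g psi).
Let dg (h : bool -> bool) (a : T * bool) : T * bool := (g a.1, h a.2).

(** [dquad] only compares and copies bits, so [h] may be negation; this is how an action of order
    [p] becomes one of order [2p]. *)
Lemma dquad_equi h : injective h -> equivariant (dg h) dquad.
Proof.
move=> hI [a e] [b f] [c k]; rewrite /dquad /dg /= !(inj_eq hI).
by case: ifP => _; [case: ifP => _ | case: ifP => _]; rewrite /= ?qg ?phig.
Qed.

Lemma dpar_equi : equivariant (dg id) dpar.
Proof.
move=> [a e] [b f] [c k]; rewrite /dpar /dg /=.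
by case: ifP => _; [|case: ifP => _]; rewrite /= ?phig ?psig.
Qed.

Lemma dlatin_equi : equivariant (dg id) dlatin.
Proof. by move=> [a e] [b f] [c k]; rewrite /dlatin /dg /= psig. Qed.
End Equivariance.

(* A block fixed by the flip consists of two copies of a self-parallel edge. *)
Lemma dquad_flip (a : T * bool) :
  exists b, [/\ b != a, b.2 = a.2 &
    forall c, c != a -> c.2 = a.2 -> (dquad a (a.1, ~~ a.2) c == (c.1, ~~ c.2)) = (c == b)].
Proof.
case: a => a e; have [b ab bP] := par_self phiP a.
exists (b, e); split=> // [|[c f]]; first by rewrite xpair_eqE eqxx andbT eq_sym.
move=> /= ca fe; move: ca; rewrite {f}fe !xpair_eqE !eqxx !andbT eq_sym => ac.
rewrite -(bP _ ac) /dquad /=; case: e => /=; by rewrite xpair_eqE andbT.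
Qed.
End Doubling.

(** * Blocks and orbits *)

Section Blocks.
Variables (T : finType) (q : T -> T -> T -> T).
Hypothesis qP : quad_law q.

Definition block (a b c : T) : {set T} := [set a; b; c; q a b c].
Definition blocks : {set {set T}} :=
  [set X | [exists a, exists b, exists c, [&& a != b, a != c, b != c & X == block a b c]]].

Lemma blocksP X :
  reflect (exists a b c, [/\ a != b, a != c, b != c & X = block a b c]) (X \in blocks).
Proof.
rewrite inE; apply: (iffP existsP) => [[a /existsP[b /existsP[c /and4P[? ? ? /eqP->]]]]|].
  by exists a, b, c.
case=> a [b [c [ab ac bc ->]]]; exists a; apply/existsP; exists b; apply/existsP; exists c.
by rewrite ab ac bc eqxx.
Qed.

Lemma quad_neq1 a b c : a != b -> a != c -> b != c -> a != q a b c.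
Proof.
by move=> ab ac bc; rewrite eq_sym (quadCA qP) (quadAC qP); apply: (quad_neq qP); rewrite // eq_sym.
Qed.

Lemma quad_neq2 a b c : a != b -> a != c -> b != c -> b != q a b c.
Proof. by move=> ab ac bc; rewrite eq_sym (quadAC qP); apply: (quad_neq qP); rewrite // eq_sym. Qed.

Lemma quad_neq3 a b c : a != b -> a != c -> b != c -> c != q a b c.
Proof. by move=> ab ac bc; rewrite eq_sym; apply: (quad_neq qP). Qed.

Lemma card_block X : X \in blocks -> #|X| = 4.
Proof.
case/blocksP=> a [b [c [ab ac bc ->]]].
rewrite /block -!setUA !cardsU1 cards1 !inE !negb_or.
by rewrite ab ac bc quad_neq1 ?quad_neq2 ?quad_neq3.
Qed.

Lemma block12 a b c : block a b c = block b a c.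
Proof. by rewrite /block (quadCA qP) (setUC [set a]). Qed.

Lemma block23 a b c : block a b c = block a c b.
Proof. by rewrite /block (quadAC qP) (setUAC [set a]). Qed.

Lemma block34 a b c : a != b -> a != c -> b != c -> block a b c = block a b (q a b c).
Proof. by move=> ab ac bc; rewrite /block (quadK qP) // (setUAC [set a; b]). Qed.

(** The defining points are exchanged one at a time for [a], [b], [c]; [block34] serves when the new
    point is the fourth one. *)
Lemma block_uniq X a b c : X \in blocks -> a \in X -> b \in X -> c \in X ->
  a != b -> a != c -> b != c -> X = block a b c.
Proof.
move=> XB aX bX cX ab ac bc.
have [b1 [c1 [ab1 ac1 bc1 XE]]] :
    exists b1 c1, [/\ a != b1, a != c1, b1 != c1 & X = block a b1 c1].
  case/blocksP: XB aX => x [y [z [xy xz yz ->]]].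
  have [xw yw zw] := And3 (quad_neq1 xy xz yz) (quad_neq2 xy xz yz) (quad_neq3 xy xz yz).
  rewrite !inE -!orbA => /or4P[] /eqP->.
  - by exists y, z.
  - by exists x, z; split; rewrite // 1?eq_sym // block12.
  - by exists x, y; split; rewrite // 1?eq_sym // block23 block12.
  - by exists x, y; split; rewrite // 1?eq_sym // block34 // block23 block12.
have [c2 [ac2 bc2 {}XE]] : exists c2, [/\ a != c2, b != c2 & X = block a b c2].
  have [aw bw cw] := And3 (quad_neq1 ab1 ac1 bc1) (quad_neq2 ab1 ac1 bc1) (quad_neq3 ab1 ac1 bc1).
  move: bX; rewrite XE !inE -!orbA => /or4P[] /eqP bE; rewrite bE ?eqxx // in ab *.
  - by exists c1.
  - by exists b1; split; rewrite // 1?eq_sym // block23.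
  - by exists b1; split; rewrite // 1?eq_sym // block34 // block23.
move: cX; rewrite XE !inE -!orbA => /or4P[] /eqP cE; rewrite cE ?eqxx // in ac bc *.
by rewrite -block34.
Qed.

Lemma mem_block a b c : [/\ a \in block a b c, b \in block a b c & c \in block a b c].
Proof. by rewrite !inE !eqxx ?orbT. Qed.

(** Ordered triples of distinct points are counted by the block they span: each block has 4 * 3 * 2
    of them. *)
Lemma card_blocks : #|blocks| * 24 = #|T| * (#|T| - 1) * (#|T| - 2).
Proof.
pose D := [set t : 3.-tuple T | all [in T] t & uniq t].
pose blk (t : 3.-tuple T) := block (tnth t ord0) (tnth t (inord 1)) (tnth t (inord 2)).
have tE (a b c : T) : blk [tuple a; b; c] = block a b c.
  by rewrite /blk !(tnth_nth a) /= !inordK.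
have <- : #|D| = #|T| * (#|T| - 1) * (#|T| - 2).
  by rewrite card_uniq_tuples !ffactnS ffactn0 muln1 !subn1 subn2 mulnA.
have tupP (t : 3.-tuple T) : exists a b c, t = [tuple a; b; c].
  case: t => [[|a [|b [|c [|]]]]] //= i; exists a, b, c; exact: val_inj.
have UE (a b c : T) : uniq [tuple a; b; c] = [&& a != b, a != c & b != c].
  by rewrite /= !inE negb_or andbT andbA.
have DE (a b c : T) : ([tuple a; b; c] \in D) = [&& a != b, a != c & b != c].
  by rewrite inE UE andb_idl // => _; apply/allP.
rewrite -[RHS]sum1_card [RHS](partition_big blk (mem blocks)) /=; last first.
  move=> t; have [a [b [c ->]]] := tupP t; rewrite DE tE => /and3P[ab ac bc].
  by apply/blocksP; exists a, b, c.
rewrite (eq_bigr (fun=> 24)) ?sum_nat_const // => X XB.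
rewrite sum1_card -[24]/(4 ^_ 3) -(card_block XB) -card_uniq_tuples.
apply: eq_card => t; have [a [b [c ->]]] := tupP t.
rewrite [LHS]inE DE tE [RHS]inE UE [RHS]andbC.
case: and3P => //= -[ab ac bc]; rewrite andbT.
apply/eqP/and3P => [<-|[aX bX cX]]; last by rewrite -(block_uniq XB).
by case: (mem_block a b c).
Qed.
End Blocks.

(** * Codes from shift-invariant quadruple systems *)

Section Code.
Variables (u p w : nat).
Hypotheses (wE : w.+2 = 2 * p) (p_prime : prime p) (p_gt4 : 4 < p).
Local Notation T := ('I_u * 'I_w.+2)%type.
Variable q : T -> T -> T -> T.

Definition shift (r : 'I_w.+2) (a : T) : T := (a.1, (a.2 + r)%R).
Local Notation turn := (shift (p%:R)%R).

Hypotheses (qP : quad_law q) (q_shift1 : equivariant (shift 1%R) q).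
(** Each point lies on exactly one block invariant under the half turn, so these blocks partition
    the points. *)
Hypothesis q_turn : forall a, exists b, [/\ b != a, b != turn a &
  forall c, c != a -> c != turn a -> (q a (turn a) c == turn c) = (c == b) || (c == turn b)].

Lemma shift0 a : shift 0%R a = a.
Proof. by case: a => i j; rewrite /shift addr0. Qed.

Lemma shiftD r t a : shift r (shift t a) = shift (t + r)%R a.
Proof. by rewrite /shift /= addrA. Qed.

Lemma shift_inj r : injective (shift r).
Proof. by apply: (can_inj (g := shift (- r)%R)) => a; rewrite shiftD subrr shift0. Qed.

Lemma shift_free r a : shift r a = a -> r = 0%R.
Proof. by case: a => i j [/eqP]; rewrite -[X in _ == X]addr0 (inj_eq (addrI _)) => /eqP. Qed.

Lemma q_shift r : equivariant (shift r) q.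
Proof.
rewrite -(natr_Zp r); elim: (nat_of_ord r) => [|k IH] a b c; first by rewrite !shift0.
by rewrite -natr1 -!(shiftD 1%R) q_shift1 IH.
Qed.

Lemma half_half : (p%:R + p%:R)%R = 0%R :> 'I_w.+2.
Proof. by rewrite -natrD addnn -mul2n -wE; exact: (@pchar_Zp w.+2). Qed.

Lemma half_neq0 : (p%:R != 0 :> 'I_w.+2)%R.
Proof.
apply/eqP => /(congr1 val); rewrite [val _](@val_Zp_nat w.+2) //= modn_small; lia.
Qed.

Lemma turnK : involutive turn.
Proof. by move=> a; rewrite shiftD half_half shift0. Qed.

Lemma turn_neq a : turn a != a.
Proof. by apply/eqP => /shift_free /eqP; rewrite (negPf half_neq0). Qed.

Definition shifts (r : 'I_w.+2) (X : {set T}) : {set T} := shift r @: X.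

Lemma shifts0 X : shifts 0%R X = X.
Proof. by rewrite /shifts -[RHS]imset_id; apply: eq_imset; apply: shift0. Qed.

Lemma shiftsD r t X : shifts r (shifts t X) = shifts (t + r)%R X.
Proof. by rewrite /shifts -imset_comp; apply: eq_imset => a; apply: shiftD. Qed.

Lemma shifts_blocks r X : (shifts r X \in blocks q) = (X \in blocks q).
Proof.
have imp t Y : Y \in blocks q -> shifts t Y \in blocks q.
  case/blocksP=> a [b [c [ab ac bc ->]]]; apply/blocksP.
  exists (shift t a), (shift t b), (shift t c); rewrite !(inj_eq (@shift_inj t)).
  by split=> //; rewrite /shifts /block !imsetU !imset_set1 q_shift.
by apply/idP/idP; [move/(imp (- r)%R); rewrite shiftsD subrr shifts0 | apply: imp].
Qed.

Definition short_blocks : {set {set T}} := [set X in blocks q | shifts (p%:R)%R X == X].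
Definition full_blocks : {set {set T}} := blocks q :\: short_blocks.

Lemma mem_shifts r X a : (shift r a \in shifts r X) = (a \in X).
Proof. by rewrite mem_imset //; apply: shift_inj. Qed.

Lemma short_block_at a :
  exists2 X, X \in short_blocks & forall Y, Y \in short_blocks -> (a \in Y) = (Y == X).
Proof.
have [b [ba bta bP]] := q_turn a; have ta := turn_neq a.
have qb : q a (turn a) b = turn b by apply/eqP; rewrite bP // eqxx.
have XB : block q a (turn a) b \in blocks q.
  by apply/blocksP; exists a, (turn a), b; rewrite eq_sym ta eq_sym ba eq_sym bta.
exists (block q a (turn a) b).
  rewrite inE XB /= /shifts /block !imsetU !imset_set1 qb !turnK.
  by rewrite (setUC [set turn a]) -setUA (setUC [set turn b]) setUA.
move=> Y; rewrite inE => /andP[YB /eqP Yt]; apply/idP/eqP => [aY|->]; last first.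
  by rewrite !inE eqxx.
have taY : turn a \in Y by rewrite -Yt mem_shifts.
have [c /andP[cY]] : exists c, (c \in Y) && (c \notin [set a; turn a]).
  apply/existsP; apply: contraTT isT; rewrite negb_exists => /forallP sub.
  have /subset_leq_card : Y \subset [set a; turn a].
    by apply/subsetP => c cY; have := sub c; rewrite cY negbK.
  by rewrite (card_block qP YB) cards2; case: (_ != _).
rewrite !inE negb_or => /andP[ca cta].
have YE : Y = block q a (turn a) c by apply: block_uniq; rewrite // eq_sym.
have : turn c \in Y by rewrite -Yt mem_shifts.
rewrite YE !inE -!orbA (can2_eq turnK turnK) (negPf cta) (inj_eq (@shift_inj _)) (negPf ca).
rewrite (negPf (turn_neq c)) /= eq_sym bP // => /orP[]/eqP-> //.
by rewrite -qb -block34 // eq_sym.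
Qed.

Lemma card_short : #|short_blocks| * 4 = #|{: T}|.
Proof.
rewrite -cardsT; apply/esym/card_uniform_partition.
  by move=> X; rewrite inE => /andP[XB _]; apply: card_block XB.
apply/and3P; split.
- apply/eqP/setP => a; rewrite inE; apply/bigcupP.
  by have [X XS XP] := short_block_at a; exists X => //; rewrite XP.
- apply/trivIsetP => X Y XS YS; apply: contraR => /pred0Pn[a /andP[/= aX aY]].
  have [Z _ ZP] := short_block_at a; rewrite ZP // in aX; rewrite ZP // in aY.
  by rewrite (eqP aX) (eqP aY).
- by apply/negP; rewrite inE => /andP[/(card_block qP)]; rewrite cards0.
Qed.

(** If [r] is odd, its [p]-th multiple is the half turn, which does not fix a full block. If [r] is
    even and nonzero, it has order [p > 4], and a point of [X] would have at least 5 images in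
    [X]. *)
Lemma shifts_free r X : X \in full_blocks -> shifts r X = X -> r = 0%R.
Proof.
case/setDP=> XB; rewrite inE XB /= => Xt rX.
have rkX k : shifts (r *+ k)%R X = X.
  by elim: k => [|k IH]; rewrite ?mulr0n ?shifts0 // mulrS addrC -shiftsD IH.
have val_rk k : nat_of_ord (r *+ k)%R = (r * k) %% (2 * p).
  by rewrite -wE -{1}(natr_Zp r) -mulrnA [LHS](@val_Zp_nat w.+2).
have [odd_r|even_r] := boolP (odd r).
  case/eqP: Xt; rewrite -[RHS](rkX p); congr (shifts _ X).
  apply: val_inj; rewrite /= val_rk.
  have -> : nat_of_ord (p%:R : 'I_w.+2)%R = p %% (2 * p).
    by rewrite -wE [LHS](@val_Zp_nat w.+2).
  have -> : r * p = r./2 * (2 * p) + p by have := odd_double_half r; rewrite odd_r; nia.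
  by rewrite modnMDl.
apply/eqP; apply: contraTT isT => r_neq0; have r_gt0 : 0 < r by rewrite lt0n.
have /card_gt0P[a aX] : 0 < #|X| by rewrite (card_block qP XB).
pose f (k : 'I_5) := shift (r *+ k)%R a.
have /card_in_imset fI : {in [set: 'I_5] &, injective f}.
  move=> k l _ _ /(congr1 snd) rkl.
  have kl : r * k == r * l %[mod 2 * p] by rewrite -!val_rk (addrI a.2 rkl).
  wlog le_kl : k l kl {rkl} / k <= l => [IH|].
    by have [/IH->|/ltnW/IH->] // := leqP k l; rewrite eq_sym.
  move: kl; rewrite eq_sym eqn_mod_dvd ?leq_mul2l ?le_kl ?orbT // -mulnBr.
  rewrite -(even_halfK even_r) -mul2n -mulnA dvdn_pmul2l // Euclid_dvdM //.
  have r_lt : r < 2 * p by rewrite -wE.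
  have l_lt := ltn_ord l; have rE := even_halfK even_r.
  case/orP => /dvdn_leq dvd; first by have : p <= r./2 by [apply: dvd; lia]; lia.
  apply: val_inj => /=; have [kl|lk] := ltnP k l; last by lia.
  by have : p <= l - k by [apply: dvd; lia]; lia.
have /subset_leq_card : f @: [set: 'I_5] \subset X.
  by apply/subsetP => _ /imsetP[k _ ->]; rewrite -(rkX k) mem_shifts.
by rewrite fI cardsT card_ord (card_block qP XB).
Qed.

Definition shift_rel : rel {set T} := [rel X Y | [exists r, Y == shifts r X]].

Lemma shift_rel_equiv : equivalence_rel shift_rel.
Proof.
apply/equivalence_relP; split=> [X|X Y /existsP[r /eqP->] Z].
  by apply/existsP; exists 0%R; rewrite shifts0.
apply/existsP/existsP => -[t /eqP->]; [exists (t - r)%R | exists (r + t)%R].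
  by rewrite shiftsD addrC subrK.
by rewrite shiftsD.
Qed.

Definition orbits := equivalence_partition shift_rel full_blocks.
Definition reps := transversal orbits full_blocks.

Lemma orbits_partition : partition orbits full_blocks.
Proof. by apply: equivalence_partitionP => X Y Z _ _ _; apply: shift_rel_equiv. Qed.

Lemma shifts_full r X : (shifts r X \in full_blocks) = (X \in full_blocks).
Proof.
rewrite !in_setD ![_ \in short_blocks]inE !shifts_blocks shiftsD addrC -shiftsD.
case: (X \in _) => //=.
rewrite !andbT; congr (~~ _); apply/eqP/eqP => [|-> //].
exact: (imset_inj (@shift_inj r)).
Qed.

Lemma card_reps : #|full_blocks| = #|reps| * w.+2.
Proof.
rewrite (card_transversal (transversalP orbits_partition)).
apply: card_uniform_partition orbits_partition => _ /imsetP[X XF ->].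
rewrite -[RHS]card_ord -cardsT -(card_in_imset (f := fun r => shifts r X)).
  apply: eq_card => Y; rewrite inE; apply/andP/imsetP => [[_ /existsP[r /eqP->]]|[r _ ->]].
    by exists r; rewrite ?inE.
  by rewrite shifts_full XF; split=> //; apply/existsP; exists r.
move=> r t _ _ /(congr1 (shifts (- t)%R)); rewrite !shiftsD subrr shifts0.
by move/(shifts_free XF)/subr0_eq.
Qed.

Lemma reps_sub X : X \in reps -> X \in full_blocks.
Proof. by apply/subsetP; case/and3P: (transversalP orbits_partition). Qed.

Lemma reps_uniq r X Y : X \in reps -> Y \in reps -> shifts r X = Y -> X = Y.
Proof.
move=> XR YR XY; case/and3P: (transversalP orbits_partition) => _ _ /forallP tr.
pose B := [set Z in full_blocks | shift_rel X Z].
have BP : B \in orbits by apply: imset_f; apply: reps_sub.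
have /cards1P[Z ZE] : #|reps :&: B| == 1 by have := tr B; rewrite BP.
have -> : X = Z.
  apply/set1P; rewrite -ZE in_setI XR inE (reps_sub XR).
  by apply/existsP; exists 0%R; rewrite shifts0.
apply/esym/set1P; rewrite -ZE in_setI YR inE (reps_sub YR).
by apply/existsP; exists r; rewrite XY.
Qed.

Definition incidence (X : {set T}) : 'M[bool]_(u, w.+2) := \matrix_(i, j) ((i, j) \in X).

Lemma incidence_inj : injective incidence.
Proof.
by move=> X Y /matrixP XY; apply/setP => -[i j]; have := XY i j; rewrite !mxE.
Qed.

Lemma hweight_incidence X : hweight (incidence X) = #|X|.
Proof.
rewrite /hweight pair_big /= -sum1_card [RHS]big_mkcond /=.
by apply: eq_bigr => -[i j] _; rewrite mxE; case: (_ \in _).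
Qed.

Lemma corr_incidence X Y (r : int) (t : 'I_w.+2) : Posz t = (r %% Posz w.+2)%Z ->
  corr (incidence X) (incidence Y) r = #|[set a in X | shift t a \in Y]|.
Proof.
move=> tE; rewrite /corr pair_big /= -sum1_card [RHS]big_mkcond /=.
apply: eq_bigr => -[i j] _ /=; rewrite (big_pred1 (j + t)%R) => [|k /=].
  by rewrite !mxE inE; case: (_ \in X); case: (_ \in Y).
rewrite -[in LHS]modzDmr -tE -PoszD modz_nat; apply/eqP/eqP => [[kE]|->] //.
exact: val_inj.
Qed.

(** A correlation above 2 gives a shift of one block three points in common with another block, so
    the two coincide. *)
Theorem shift_invariant_quad_code : coprime 3 (u * w.+2) ->
  exists C : {set 'M[bool]_(u, w.+2)}, is_OOC_4_2 C /\ #|C| = Jstar u w.+2.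
Proof.
move=> co3; exists (incidence @: reps); split; [split|].
- move=> _ /imsetP[X XR ->]; rewrite hweight_incidence.
  by have /setDP[/(card_block qP)] := reps_sub XR.
- move=> _ _ r /imsetP[X XR ->] /imsetP[Y YR ->] rXY.
  have [t tE] : exists t : 'I_w.+2, Posz t = (r %% Posz w.+2)%Z.
    have : (0 <= (r %% Posz w.+2)%Z)%R by rewrite modz_ge0.
    have : ((r %% Posz w.+2)%Z < Posz w.+2)%R by rewrite ltz_pmod.
    by case: (_ %% _)%Z => // k kv _; exists (Ordinal (kv : k < w.+2)).
  rewrite (corr_incidence _ _ tE) leqNgt; apply/negP => /card_gt2P[a [b [c [[]]]]].
  rewrite !inE => /andP[aX aY] /andP[bX bY] /andP[cX cY] [ab bc ca].
  have [XB YB] : X \in blocks q /\ Y \in blocks q.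
    by split; [have /setDP[] := reps_sub XR | have /setDP[] := reps_sub YR].
  have XY : shifts t X = Y.
    rewrite (block_uniq qP YB aY bY cY) ?(inj_eq (@shift_inj t)) //; last by rewrite eq_sym.
    by apply: block_uniq; rewrite ?mem_shifts ?shifts_blocks ?(inj_eq (@shift_inj t)) // eq_sym.
  have eXY := reps_uniq XR YR XY; case: rXY => [|]; first by rewrite eXY eqxx.
  rewrite -tE (shifts_free (reps_sub XR) (_ : shifts t X = X)) //.
  by rewrite XY.
rewrite card_imset; last exact: incidence_inj.
have := card_blocks qP; have := card_short; have := card_reps.
have -> : #|full_blocks| = #|blocks q| - #|short_blocks|.
  rewrite cardsD (setIidPr _) //; apply/subsetP => X; by rewrite inE => /andP[].
rewrite card_prod !card_ord /Jstar.
move: #|blocks q| #|short_blocks| #|reps| => B S C BS S4 B24.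
have n_even : ~~ odd (u * w.+2) by rewrite wE oddM oddM andbF.
have [h hE] : exists h, u * w.+2 - 2 = 2 * h by exists (u * w.+2 - 2)./2; lia.
(* With [n = u * w.+2], 3 divides [n (n - 1) (n - 2)] by the block count, but not [n]; hence this
   floor in [Jstar] is exact. *)
have [k kE] : exists k, (u * w.+2 - 1) * h = k * 3.
  apply/dvdnP; rewrite -(Gauss_dvdr _ (isT : coprime 3 2)) -(Gauss_dvdr _ co3).
  by apply/dvdnP; exists (B * 8); rewrite -[B * _ * _]mulnA B24 hE; lia.
rewrite hE mulKn // kE mulnK //.
have [u0|u_gt0] := posnP u; first by nia.
(* Since [4 * B = n * k] and [4 * S = n], the outer floor is exact too. *)
have uk : u * (k - 1) * w.+2 = 4 * C * w.+2.
  rewrite -[4 * C * _]mulnA -BS mulnBr mulnBr mulnBl.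
  have -> : 4 * B = u * w.+2 * k.
    apply/eqP; rewrite -(eqn_pmul2l (isT : 0 < 6)) mulnA [6 * 4 * B]mulnC B24 hE; apply/eqP.
    by rewrite -mulnA [(_ - 1) * _]mulnCA kE; lia.
  by rewrite [4 * S]mulnC S4; lia.
by move/eqP: uk; rewrite eqn_pmul2r // => /eqP->; rewrite mulKn.
Qed.
End Code.

(** * The four-fibre system *)

Inductive lexp :=
  LVar of nat | LAdd of lexp & lexp | LOpp of lexp | LMul of lexp & nat | LDiv of lexp.

Definition lvec := (int * int * int * int)%type.

Section LinearForms.
Local Open Scope ring_scope.

Definition lscale (n : int) (t : lvec) : lvec :=
  let: (a, b, c, d) := t in (n * a, n * b, n * c, n * d).
Definition ladd (t u : lvec) : lvec :=
  let: (a, b, c, d) := t in let: (a', b', c', d') := u in (a + a', b + b', c + c', d + d').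

(* Linear forms in four variables over [Z[1/6]]: [(k, (a, b, c, d))] stands for
   [(a x + b y + c z + d t) / 6 ^ k]. *)
Fixpoint lnorm (e : lexp) : nat * lvec :=
  match e with
  | LVar n => (0%N, nth (0, 0, 0, 1) [:: (1, 0, 0, 0); (0, 1, 0, 0); (0, 0, 1, 0)] n)
  | LAdd e f => let: (k, t) := lnorm e in let: (l, u) := lnorm f in
      (maxn k l, ladd (lscale (6 ^+ (l - k)) t) (lscale (6 ^+ (k - l)) u))
  | LOpp e => let: (k, t) := lnorm e in (k, lscale (-1) t)
  | LMul e n => let: (k, t) := lnorm e in (k, lscale (Posz n) t)
  | LDiv e => let: (k, t) := lnorm e in (k.+1, t)
  end.

(* [n] is of the form [2^a 3^b]; [k] is fuel. *)
Fixpoint smooth6 (k n : nat) : bool :=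
  if k is k'.+1 then
    if n == 1%N then true
    else if odd n then if (3 %| n)%N then smooth6 k' (n %/ 3)%N else false
    else smooth6 k' n./2
  else false.

Definition lin0 (g : lexp) : bool := (lnorm g).2 == (0, 0, 0, 0).

(* [lin1 e g] ([lin2 e f g]): [e = 0] (resp. [e = f = 0]) implies [g = 0], by Cramer's rule on the
   first two coefficients with a determinant invertible in [Z[1/6]].  This is complete when the
   coefficients add up to 0. *)
Definition lin1 (e g : lexp) : bool :=
  let t := (lnorm e).2 in let u := (lnorm g).2 in
  let: (n, c) := if t.1.1.1 != 0 then (t.1.1.1, u.1.1.1) else (t.1.1.2, u.1.1.2) in
  smooth6 20 `|n|%N && (lscale n u == lscale c t).

Definition lin2 (e f g : lexp) : bool :=
  let t := (lnorm e).2 in let u := (lnorm f).2 in let w := (lnorm g).2 in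
  let n := t.1.1.1 * u.1.1.2 - t.1.1.2 * u.1.1.1 in
  smooth6 20 `|n|%N &&
  (lscale n w == ladd (lscale (w.1.1.1 * u.1.1.2 - w.1.1.2 * u.1.1.1) t)
                      (lscale (t.1.1.1 * w.1.1.2 - t.1.1.2 * w.1.1.1) u)).

Variables (R : comPzRingType) (s : R).
Hypothesis six_s : s *+ 6 = 1.
Variables x y z t : R.

Fixpoint leval (e : lexp) : R :=
  match e with
  | LVar n => nth t [:: x; y; z] n
  | LAdd e f => leval e + leval f
  | LOpp e => - leval e
  | LMul e n => leval e *+ n
  | LDiv e => s * leval e
  end.

Definition lval (v : lvec) : R :=
  let: (a, b, c, d) := v in x *~ a + y *~ b + z *~ c + t *~ d.

Lemma lvalD v w : lval (ladd v w) = lval v + lval w.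
Proof.
case: v w => [[[a b] c] d] [[[a' b'] c'] d'] /=.
by rewrite !mulrzDr; do 3![rewrite [RHS]addrACA; congr (_ + _)].
Qed.

Lemma lvalZ n v : lval (lscale n v) = lval v *~ n.
Proof. by case: v => [[[a b] c] d]; rewrite /= !mulrzDl -!mulrzA !(mulrC n). Qed.

Lemma exp_s6 k : s ^+ k *~ (6 ^+ k) = 1.
Proof.
elim: k => [|k IH]; first by rewrite !expr0 mulr1z.
by rewrite !exprSr mulrzA -mulrzAl IH mul1r.
Qed.

Lemma leval_norm e : leval e = s ^+ (lnorm e).1 * lval (lnorm e).2.
Proof.
have align k l (r : R) : s ^+ k * r = s ^+ (maxn k l) * (r *~ (6 ^+ (l - k))).
  by rewrite maxnE exprD -mulrA; congr (_ * _); rewrite mulrzAr -mulrzAl exp_s6 mul1r.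
elim: e => [n|e IHe f IHf|e IHe|e IHe n|e IHe] /=.
- by rewrite mul1r; case: n => [|[|[|[|n]]]] /=; rewrite mulr1z !mulr0z ?addr0 ?add0r.
- rewrite {}IHe {}IHf; case: (lnorm e) (lnorm f) => k v [l w] /=.
  by rewrite lvalD !lvalZ mulrDr (align k l) (align l k) maxnC.
- by rewrite {}IHe; case: (lnorm e) => k v /=; rewrite lvalZ mulrN1z mulrN.
- by rewrite {}IHe; case: (lnorm e) => k v /=; rewrite lvalZ -pmulrn mulrnAr.
- by rewrite {}IHe; case: (lnorm e) => k v /=; rewrite exprS mulrA.
Qed.

Lemma lval_eq0 e : leval e = 0 -> lval (lnorm e).2 = 0.
Proof.
by rewrite leval_norm => /(congr1 ( *~%R^~ (6 ^+ (lnorm e).1)));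
   rewrite -mulrzAl exp_s6 mul1r mul0rz.
Qed.

Lemma smooth6_cancel k n (r : R) : smooth6 k n -> r *+ n = 0 -> r = 0.
Proof.
elim: k n r => //= k IH n r; have [-> //|_] := eqVneq n 1%N.
have [_|/even_halfK nE] := boolP (odd n).
  case: ifP => // /divnK nE sn rn0.
  have {}IH: r *+ 3 = 0 by apply: IH sn _; rewrite -mulrnA mulnC nE.
  by rewrite -[r]mul1r -six_s mulrnAl (mulrnA _ 3 2) -mulrnAr IH mulr0 mul0rn.
move=> sn rn0.
have {}IH: r *+ 2 = 0 by apply: IH sn _; rewrite -mulrnA mul2n nE.
by rewrite -[r]mul1r -six_s mulrnAl (mulrnA _ 2 3) -mulrnAr IH mulr0 mul0rn.
Qed.

Lemma smooth6_cancelz k n (r : R) : smooth6 k `|n|%N -> r *~ n = 0 -> r = 0.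
Proof.
case: n => n /= sn; first exact: smooth6_cancel sn.
by rewrite NegzE mulrNz => /eqP; rewrite oppr_eq0 => /eqP; apply: smooth6_cancel sn.
Qed.

Lemma lin0P g : lin0 g -> leval g = 0.
Proof. by rewrite leval_norm => /eqP->; rewrite /= !mulr0z !addr0 mulr0. Qed.

Lemma lin1P e g : lin1 e g -> leval e = 0 -> leval g = 0.
Proof.
rewrite /lin1 (leval_norm g); set v := (lnorm e).2; set w := (lnorm g).2.
case: ifP => _ /andP[sn /eqP eqv] /lval_eq0 e0;
  by rewrite [lval w](smooth6_cancelz sn) ?mulr0 // -lvalZ eqv lvalZ e0 mul0rz.
Qed.

Lemma lin2P e f g : lin2 e f g -> leval e = 0 -> leval f = 0 -> leval g = 0.
Proof.
rewrite /lin2 (leval_norm g); move=> /andP[sn /eqP eqv] /lval_eq0 e0 /lval_eq0 f0.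
by rewrite [lval _](smooth6_cancelz sn) ?mulr0 // -lvalZ eqv lvalD !lvalZ e0 f0 !mul0rz addr0.
Qed.

(** This and the next two lemmas are the entry points of [lin_solve]: reified forms match the goal
    and hypotheses by conversion, leaving a boolean to compute. *)
Lemma lin_close (a b : R) (g : lexp) :
  leval g = a - b -> lin0 g -> a = b.
Proof. by move=> E /lin0P; rewrite E => /subr0_eq. Qed.

Lemma lin_close1 (a b a1 b1 : R) (e g : lexp) :
  leval e = a1 - b1 -> leval g = a - b -> a1 = b1 -> lin1 e g -> a = b.
Proof.
move=> E G E1 /lin1P L; apply: subr0_eq; rewrite -G; apply: L.
by rewrite E E1 subrr.
Qed.

Lemma lin_close2 (a b a1 b1 a2 b2 : R) (e f g : lexp) :
  leval e = a1 - b1 -> leval f = a2 - b2 -> leval g = a - b ->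
  a1 = b1 -> a2 = b2 -> lin2 e f g -> a = b.
Proof.
move=> E F G E1 E2 /lin2P L; apply: subr0_eq; rewrite -G; apply: L.
  by rewrite E E1 subrr.
by rewrite F E2 subrr.
Qed.

End LinearForms.

Section FourFibres.
Local Open Scope ring_scope.
Variables (R : comNzRingType) (s : R).
Hypothesis six_s : s *+ 6 = 1.
Local Notation pt := (R * (bool * bool))%type.

Definition third (e : R) := s * (e *+ 2).
Definition half (e : R) := s * (e *+ 3).

(* The fibres are numbered by two bits: 0 = (false, false), 1 = (false, true), 2 = (true, false),
   3 = (true, true).  Write [i'] for [i] with its second bit flipped, [i*] for [i] with both bits
   flipped.  The generic blocks are
     [{(i, x), (i, y), (i, z), (i', w)}] with [x + y + z = 3w],
     [{(i, x), (i, y), (j, z), (j, w)}] with [x + y = z + w], [j] differing from [i] and [i'],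
     [{(0, x0), (1, x1), (2, x2), (3, x3)}] with [x0 - x1 = 2 (x2 - x3)].
   From these are removed those of the second kind with [j = i*] and [{x, y} = {z, w}], and those
   of the third kind, other than [x0 = x1 = x2 = x3], with [x0 = x1], [x1 = x2] or [x0 = x3].
   The blocks added instead, for nonzero [d], are
     [{(i, m - d), (i, m + d), (j, m), (j', m)}] with [i], [j] differing in the first bit,
     [{(i, t), (i, t + 3d), (i', t + 2d), (i*, t + 3d)}] for [i = 0, 1], and the same with [(i*, t)]
     for [i = 2, 3].
   [fib_quad_two h k x y z] completes [(h, x), (h, y), (k, z)]; [fib_quad_lone l xs xd z] completes
   [(l, z)] and two points of the other half, [xs] being the one with the same second bit as [l]. *)
Definition fib_quad_two (h k : bool * bool) (x y z : R) : pt :=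
  if k.1 == h.1 then
    if z *+ 3 == x *+ 2 + y then (if h.1 then y else x, (~~ h.1, ~~ h.2))
    else if z *+ 3 == x + y *+ 2 then (if h.1 then x else y, (~~ h.1, ~~ h.2))
    else (z *+ 3 - x - y, h)
  else if z *+ 2 == x + y then (z, (k.1, ~~ k.2))
  else if k.2 == h.2 then (x + y - z, k)
  else if z == x then (third (if h.1 then x + y *+ 2 else x *+ 2 + y), (h.1, ~~ h.2))
  else if z == y then (third (if h.1 then x *+ 2 + y else x + y *+ 2), (h.1, ~~ h.2))
  else (x + y - z, k).

Definition fib_quad_lone (l : bool * bool) (xs xd z : R) : pt :=
  let: (i, j) := l in
  if xs == xd then if z == xs then (z, (i, ~~ j)) else (xs *+ 2 - z, (i, j))
  else if i then
    if xd == z then (xs *+ 3 - xd *+ 2, (false, ~~ j))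
    else if xs *+ 3 == z *+ 2 + xd then (z, (false, ~~ j))
    else (z - half (xs - xd), (true, ~~ j))
  else
    if z == xd then (z + half ((xs - z) *+ 3), (true, ~~ j))
    else if z + xd *+ 2 == xs *+ 3 then (z, (true, ~~ j))
    else (z - (xs - xd) *+ 2, (false, ~~ j)).

Definition fib_quad_pair (a b c : pt) : pt :=
  if a.2.2 == c.2.2 then fib_quad_lone c.2 a.1 b.1 c.1 else fib_quad_lone c.2 b.1 a.1 c.1.

Definition fib_quad (a b c : pt) : pt :=
  let: (x, h) := a in let: (y, k) := b in let: (z, l) := c in
  if h == k then
    if k == l then (third (x + y + z), (h.1, ~~ h.2)) else fib_quad_two h l x y z
  else if h == l then fib_quad_two h k x z y
  else if k == l then fib_quad_two k h y z x
  else if h.1 == k.1 then fib_quad_pair a b c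
  else if h.1 == l.1 then fib_quad_pair a c b
  else fib_quad_pair b c a.

Definition translate (t : R) (a : pt) : pt := (a.1 + t, a.2).

(* Edges of difference [d] between fibres differing in one bit correspond to those of
   difference [-d], except for [d = 0] and fibres differing in the first bit: these edges join the
   edges of the same sum within a fibre, and correspond to the edges of that sum between fibres
   differing in both bits. *)
Definition fib_par (a b c : pt) : pt :=
  let: (x, (i, j)) := a in let: (y, (i', j')) := b in let: (z, (k, l)) := c in
  if i == i' then
    if j == j' then (x + y - z, (~~ k, ~~ l))
    else (if l == j then z - (y - x) else z + (y - x), (k, ~~ l))
  else if j == j' then
    if x == y then (x + y - z, (~~ k, ~~ l))
    else (if k == i then z - (y - x) else z + (y - x), (~~ k, l))
  else if z *+ 2 == x + y then (z, (~~ k, l)) else (x + y - z, (k, l)).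

(** A colour is a difference with two bit sums; corresponding colours have opposite first bit sums,
    whence [latin_neq]. *)
Definition fib_latin (a b c : pt) : pt :=
  let: (x, (i, j)) := a in let: (y, (i', j')) := b in let: (z, (k, l)) := c in
  (z + y - x, (~~ (i (+) i' (+) k), j (+) j' (+) l)).

(** * Case analysis by linear arithmetic, and the laws of the four-fibre system *)

Ltac lin_reify x y z t e :=
  lazymatch e with
  | x => constr:(LVar 0) | y => constr:(LVar 1) | z => constr:(LVar 2) | t => constr:(LVar 3)
  | ?a + ?b => let a' := lin_reify x y z t a in let b' := lin_reify x y z t b in
      constr:(LAdd a' b')
  | - ?a => let a' := lin_reify x y z t a in constr:(LOpp a')
  | ?a *+ ?n => let a' := lin_reify x y z t a in constr:(LMul a' n)
  | s * ?a => let a' := lin_reify x y z t a in constr:(LDiv a')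
  | third ?a => let a' := lin_reify x y z t a in constr:(LDiv (LMul a' 2))
  | half ?a => let a' := lin_reify x y z t a in constr:(LDiv (LMul a' 3))
  end.

Ltac vmtrue :=
  match goal with |- is_true ?b =>
    lazymatch eval vm_compute in b with true => vm_cast_no_check (erefl true) end
  end.

Ltac lin_solve x y z t :=
  lazymatch goal with |- @eq _ ?a ?b =>
    let g := lin_reify x y z t (a - b) in
    first
    [ apply: (@lin_close _ s six_s x y z t a b g erefl); vmtrue
    | match goal with E : @eq _ ?a1 ?b1 |- _ =>
        let e := lin_reify x y z t (a1 - b1) in
        apply: (@lin_close1 _ s six_s x y z t a b a1 b1 e g erefl erefl E); vmtrue end
    | match goal with E : @eq _ ?a1 ?b1, F : @eq _ ?a2 ?b2 |- _ =>
        let e := lin_reify x y z t (a1 - b1) in let f := lin_reify x y z t (a2 - b2) in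
        apply: (@lin_close2 _ s six_s x y z t a b a1 b1 a2 b2 e f g erefl erefl erefl E F);
        vmtrue end ]
  end.

Ltac lin_contra x y z t :=
  exfalso; match goal with N : ~ (@eq _ _ _) |- _ => apply: N; lin_solve x y z t end.

(** A test already decided by the context is resolved before any split, so contradictory branches
    are mostly never opened. *)
Ltac lin_branch x y z t :=
  match goal with |- context [if ?a == ?b then _ else _] =>
    first [ have /eqP -> : a = b by lin_solve x y z t
          | have /eqP/negPf -> : a <> b by move=> ?; lin_contra x y z t
          | case: (a =P b) => ? ]; cbv iota beta
  end.

Ltac fib_quad_solve x y z t :=
  rewrite /fib_quad /= /fib_quad_pair /= /fib_quad_two /fib_quad_lone /=;
  repeat lin_branch x y z t;
  by rewrite /=; congr (_, _); lin_solve x y z t.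

Lemma fib_quadCA a b c : fib_quad a b c = fib_quad b a c.
Proof.
move: a b c => [x h] [y k] [z l].
case: h k l => [[] []] [[] []] [[] []].
all: fib_quad_solve x y z z.
Qed.

Lemma fib_quadAC a b c : fib_quad a b c = fib_quad a c b.
Proof.
move: a b c => [x h] [y k] [z l].
case: h k l => [[] []] [[] []] [[] []].
all: fib_quad_solve x y z z.
Qed.

(** Once the fibres are concrete the [if] computes, leaving a disequation usable by [lin_contra], or
    nothing. *)
Lemma fibre_neq (x y : R) (h k : bool * bool) :
  (x, h) != (y, k) -> if h == k then x <> y else True.
Proof. by move=> /eqP neq; case: (h =P k) => [hk exy|//]; apply: neq; rewrite hk exy. Qed.

Lemma fib_quad_neq a b c : a != b -> a != c -> b != c -> fib_quad a b c <> c.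
Proof.
move: a b c => [x h] [y k] [z l] /fibre_neq Nxy /fibre_neq Nxz /fibre_neq Nyz.
case: h k l Nxy Nxz Nyz => [[] []] [[] []] [[] []] /= Nxy Nxz Nyz.
all: rewrite /fib_quad /= /fib_quad_pair /= /fib_quad_two /fib_quad_lone /=;
  repeat lin_branch x y z z; case=> //; try (by move=> ?; lin_contra x y z z).
Qed.

Lemma fib_quadK a b c : a != b -> a != c -> b != c -> fib_quad a b (fib_quad a b c) = c.
Proof.
move: a b c => [x h] [y k] [z l] /fibre_neq Nxy /fibre_neq Nxz /fibre_neq Nyz.
(* [Q] hides the outer operation until the inner one has been evaluated. *)
have [Q QE] : exists Q, fib_quad = Q by exists fib_quad.
rewrite {1}QE.
case: h k l Nxy Nxz Nyz => [[] []] [[] []] [[] []] /= Nxy Nxz Nyz.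
all: rewrite /fib_quad_pair /= /fib_quad_two /fib_quad_lone /=; repeat lin_branch x y z z;
  rewrite -QE /=; rewrite /fib_quad_pair /= /fib_quad_two /fib_quad_lone /=.
all: repeat lin_branch x y z z.
all: by congr (_, _); lin_solve x y z z.
Qed.

Lemma fib_quad_trans t : equivariant (translate t) fib_quad.
Proof.
move=> [x h] [y k] [z l].
case: h k l => [[] []] [[] []] [[] []]; rewrite /translate.
all: fib_quad_solve x y z t.
Qed.

Lemma fib_parC a b c : fib_par a b c = fib_par b a c.
Proof.
move: a b c => [x [i j]] [y [i' j']] [z [k l]].
move: i j i' j' k l => [] [] [] [] [] [] /=.
all: by repeat lin_branch x y z z; rewrite /=; congr (_, _); lin_solve x y z z.
Qed.

Lemma fib_par_trans t : equivariant (translate t) fib_par.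
Proof.
move=> [x [i j]] [y [i' j']] [z [k l]]; rewrite /translate.
move: i j i' j' k l => [] [] [] [] [] [] /=.
all: by repeat lin_branch x y z t; rewrite /=; congr (_, _); lin_solve x y z t.
Qed.

Lemma fib_par_neq a b c : a != b -> fib_par a b c <> c.
Proof.
move: a b c => [x [i j]] [y [i' j']] [z [k l]] /fibre_neq.
move: i j i' j' k l => [] [] [] [] [] [] /= N.
all: by repeat lin_branch x y z z; case=> // ?; lin_contra x y z z.
Qed.

Lemma fib_parK a b c : a != b -> fib_par a b (fib_par a b c) = c.
Proof.
move: a b c => [x [i j]] [y [i' j']] [z [k l]] /fibre_neq.
have [P PE] : exists P, fib_par = P by exists fib_par.
rewrite {1}PE.
move: i j i' j' k l => [] [] [] [] [] [] /= N.
all: by repeat lin_branch x y z z; rewrite -PE /=; repeat lin_branch x y z z;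
   rewrite /=; congr (_, _); lin_solve x y z z.
Qed.

Lemma fib_par_exch a b c : a != b -> fib_par c (fib_par a b c) a = b.
Proof.
move: a b c => [x [i j]] [y [i' j']] [z [k l]] /fibre_neq.
have [P PE] : exists P, fib_par = P by exists fib_par.
rewrite {1}PE.
move: i j i' j' k l => [] [] [] [] [] [] /= N.
all: by repeat lin_branch x y z z; rewrite -PE /=; repeat lin_branch x y z z;
   rewrite /=; congr (_, _); lin_solve x y z z.
Qed.

(** As 2 is invertible, negation fixes only the difference 0, and between fibres differing in the
    first bit that difference is rerouted. *)
Lemma fib_par_self a b : a != b -> (fib_par a b a == b) = (b == (a.1, (a.2.1, ~~ a.2.2))).
Proof.
move: a b => [x [i j]] [y [i' j']] /fibre_neq.
move: i j i' j' => [] [] [] [] /= N.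
all: repeat lin_branch x y x x; apply/eqP/eqP; case=> // ?;
 try (by congr (_, _); lin_solve x y x x); lin_contra x y x x.
Qed.

Lemma fib_latin_trans t : equivariant (translate t) fib_latin.
Proof.
move=> [x [i j]] [y [i' j']] [z [k l]]; rewrite /translate /=.
by congr (_, _); lin_solve x y z t.
Qed.

Lemma fib_latinK a b c : fib_latin b a (fib_latin a b c) = c.
Proof.
move: a b c => [x [i j]] [y [i' j']] [z [k l]] /=; congr (_, (_, _)).
- by lin_solve x y z z.
- by case: i i' k => [] [] [].
- by case: j j' l => [] [] [].
Qed.

Lemma fib_latin_exch a b c : fib_latin c (fib_latin a b c) a = b.
Proof.
move: a b c => [x [i j]] [y [i' j']] [z [k l]] /=; congr (_, (_, _)).
- by lin_solve x y z z.
- by case: i i' k => [] [] [].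
- by case: j j' l => [] [] [].
Qed.

Lemma fib_latin_neq a b : fib_latin a b a != b.
Proof.
move: a b => [x [i j]] [y [i' j']]; apply/eqP => -[_].
by case: i i' => [] [].
Qed.
End FourFibres.

(** * Existence *)

(* [g] acts on [T] as [p]-cycles, and [o] picks one point in each of the [u] cycles. *)
Definition row_system (p u : nat) : Prop :=
  exists (T U : finType) (g : T -> T) (o : U -> T) (q phi psi : T -> T -> T -> T),
  [/\ [/\ quad_law q, parallel_law phi & latin_law psi],
      [/\ equivariant g q, equivariant g phi & equivariant g psi],
      #|U| = u /\ #|T| = u * p,
      iter p g =1 id &
      forall r r' k k', k < p -> k' < p -> iter k g (o r) = iter k' g (o r') -> r = r' /\ k = k'].

Lemma row_system_base (m p : nat) : 0 < m -> 1 < p -> coprime 6 (m * p) -> row_system p (m * 4).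
Proof.
move=> m_gt0 p_gt1 co6; set N := m * p; have N_gt1 : 1 < N by rewrite /N; nia.
pose R := 'Z_N; pose s : R := (6%:R^-1)%R.
have six_s : (s *+ 6 = 1)%R.
  by rewrite -mulr_natr mulVr // unitZpE // coprime_sym.
pose T : finType := (R * (bool * bool))%type; pose U : finType := ('I_m * (bool * bool))%type.
(* Translation by [m] has order [p] in [Z_N]; the residues below [m] represent its cycles in each
   fibre. *)
pose g : T -> T := translate (m%:R : R)%R.
pose o (r : U) : T := ((r.1 : nat)%:R%R, r.2).
have iter_g k (x : T) : iter k g x = ((x.1 + (m * k)%:R)%R, x.2).
  elim: k => [|k /= ->]; first by rewrite muln0 addr0; case: x.
  by rewrite /g /translate /= mulnS addnC natrD addrA.
exists T, U, g, o, (fib_quad s), (@fib_par R), (@fib_latin R); split.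
- split; split.
  + exact: fib_quadCA.
  + exact: fib_quadAC.
  + by move=> *; apply/eqP/fib_quad_neq.
  + exact: fib_quadK.
  + exact: fib_parC six_s.
  + by move=> *; apply/eqP/(fib_par_neq six_s).
  + exact: fib_parK six_s.
  + exact: fib_par_exch six_s.
  + move=> a; exists (a.1, (a.2.1, ~~ a.2.2)); last exact: fib_par_self six_s _.
    by case: a => x [i []]; rewrite /= !xpair_eqE !andbF.
  + exact: fib_latinK six_s.
  + exact: fib_latin_exch six_s.
  + exact: fib_latin_neq.
- by split; [apply: fib_quad_trans | apply: fib_par_trans six_s _ | apply: fib_latin_trans six_s _].
- by rewrite !card_prod !card_bool card_ord card_ord Zp_cast // /N; lia.
- by move=> x; rewrite iter_g -/N; case: x => x h; rewrite (pchar_Zp N_gt1) addr0.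
move=> [r h] [r' h'] k k' kp kp'; rewrite !iter_g /= -!natrD => E.
have -> : h = h' by have := congr1 snd E.
have lt (i : 'I_m) l : l < p -> i + m * l < N by move=> lp; have := ltn_ord i; rewrite /N; nia.
have {}E : r + m * k = r' + m * k'.
  by have /(congr1 val) := congr1 fst E; rewrite /= !val_Zp_nat // !modn_small //; apply: lt.
have rE : r = r' :> nat.
  by have := congr1 (modn^~ m) E;
    rewrite /= !(mulnC m) ![nat_of_ord _ + _]addnC !modnMDl !modn_small.
split; first by congr (_, _); apply: val_inj.
by move: E; rewrite rE => /addnI/eqP; rewrite eqn_pmul2l // => /eqP.
Qed.

Lemma row_system_double p u : row_system p u -> row_system p (u * 2).
Proof.
case=> T [U [g [o [q [phi [psi [[qP phiP psiP] [qg phig psig] [cU cT] gp go]]]]]]].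
pose g' (a : T * bool) := (g a.1, id a.2).
have iter_g k (a : T * bool) : iter k g' a = (iter k g a.1, a.2).
  by elim: k => [|k /= ->] //; case: a.
exists (T * bool : finType)%type, (U * bool : finType)%type, g', (fun r => (o r.1, r.2)).
exists (dquad q phi), (dpar phi psi), (dlatin psi); split.
- by split; [apply: dquadP | apply: dparP | apply: dlatinP].
- by split; [apply: (dquad_equi qg phig) | apply: dpar_equi | apply: dlatin_equi].
- by rewrite !card_prod card_bool cU cT mulnAC.
- by move=> a; rewrite iter_g gp; case: a.
move=> [r e] [r' e'] k k' kp kp'; rewrite !iter_g /= => -[/go[] // -> -> ->].
by [].
Qed.

Lemma row_system_exists m p t :
  0 < m -> 1 < p -> coprime 6 (m * p) -> row_system p (m * 4 * 2 ^ t).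
Proof.
move=> m_gt0 p_gt1 co6; elim: t => [|t IH]; first by rewrite muln1; apply: row_system_base.
by rewrite expnSr mulnA; apply: row_system_double.
Qed.

(** After one more doubling, the shift by 1 is [g] combined with the exchange of copies; as [p] is
    odd, the half turn is the exchange alone. *)
Lemma code_of_row_system p u : prime p -> 4 < p -> coprime 3 (u * (2 * p)) -> row_system p u ->
  exists C : {set 'M[bool]_(u, 2 * p)}, is_OOC_4_2 C /\ #|C| = Jstar u (2 * p).
Proof.
move=> p_prime p_gt4 +
  [T [U [g [o [q [phi [psi [[qP phiP psiP] [qg phig psig] [cU cT] gp go]]]]]]]].
have [w wE] : exists w, w.+2 = 2 * p by exists (2 * p - 2); lia.
have p_odd : odd p by have [|//] := even_prime p_prime; lia.
have gMp k l x : iter (k * p + l) g x = iter l g x.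
  rewrite addnC iterD; congr iter; elim: k => // k IH.
  by rewrite mulSn iterD IH gp.
have modg k x : iter (k %% (2 * p)) g x = iter k g x.
  by rewrite [in RHS](divn_eq k (2 * p)) mulnA gMp.
pose orow (i : 'I_u) := o (enum_val (cast_ord (esym cU) i)).
(* Chinese remaindering: a column is determined by its residue mod [p] and its parity. *)
pose f (a : 'I_u * 'I_w.+2) : T * bool := (iter a.2 g (orow a.1), odd a.2).
have f_inj : injective f.
  move=> [i j] [i' j'] ff; have := congr1 fst ff; have /= oj := congr1 snd ff => /= {ff}.
  have iterp k x : iter k g x = iter (k %% p) g x by rewrite {1}(divn_eq k p) gMp.
  rewrite (iterp j) (iterp j') => /go[]; rewrite ?ltn_pmod ?prime_gt0 //.
  move/enum_val_inj/cast_ord_inj => -> jp; congr (_, _); apply: val_inj => /=.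
  have j_lt : j < 2 * p by rewrite -wE.
  have j_lt' : j' < 2 * p by rewrite -wE.
  have /eqP : j == j' %[mod 2 * p].
    rewrite chinese_remainder; last by rewrite coprime2n.
    by rewrite jp eqxx !modn2 oj eqxx.
  by rewrite !modn_small.
have [f' fK f'K] : bijective f.
  by apply: inj_card_bij => //; rewrite !card_prod !card_ord card_bool cT wE; lia.
pose q' a b c := f' (dquad q phi (f a) (f b) (f c)).
have fq a b c : f (q' a b c) = dquad q phi (f a) (f b) (f c) by rewrite /q' f'K.
have dqP := dquadP qP phiP.
have f_eq a b : (f a == f b) = (a == b) := inj_eq f_inj a b.
have q'P : quad_law q'.
  split.
  - by move=> a b c; rewrite /q' (quadCA dqP).
  - by move=> a b c; rewrite /q' (quadAC dqP).
  - by move=> a b c; rewrite -!f_eq fq; apply: (quad_neq dqP).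
  - by move=> a b c; rewrite -!f_eq => ab ac bc; apply: f_inj; rewrite !fq (quadK dqP).
have f_shift r a : f (shift r a) = (iter r g (f a).1, odd r (+) (f a).2).
  case: a => i j; rewrite /f /=; have -> : (j + r) %% w.+2 = (j + r) %% (2 * p) by rewrite -wE.
  by rewrite modg odd_mod ?oddM // oddD addbC addnC iterD.
have f_shift1 a : f (shift 1%R a) = (g (f a).1, ~~ (f a).2) by rewrite f_shift.
have f_turn a : f (shift (p%:R)%R a) = ((f a).1, ~~ (f a).2).
  rewrite f_shift; have -> : nat_of_ord (p%:R : 'I_w.+2)%R = p.
    rewrite [LHS](@val_Zp_nat w.+2) // modn_small //; lia.
  by rewrite gp p_odd.
clearbody f.
move: (@shift_invariant_quad_code u p w wE p_prime p_gt4 q' q'P); rewrite -wE; apply.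
  move=> a b c; apply: f_inj; rewrite !(fq, f_shift1).
  exact: (dquad_equi qg phig (inv_inj negbK)).
move=> a; have [b [ba b2 bP]] := dquad_flip q phiP (f a).
set turn := shift (p%:R)%R in f_turn *.
have turnK : involutive turn.
  move=> x; apply: f_inj; rewrite !f_turn negbK; by case: (f x).
have side c : c != a -> c != turn a -> (f c).2 = (f a).2 ->
    (q' a (turn a) c == turn c) = (c == f' b) || (c == turn (f' b)).
  move=> ca cta c2; rewrite -f_eq fq !f_turn bP ?f_eq // -(can_eq f'K) fK.
  suff -> : (c == turn (f' b)) = false by rewrite orbF.
  by apply/negP => /eqP cE; move: c2; rewrite cE f_turn f'K b2 /=; case: (f a).2.
exists (f' b); split; [by rewrite -f_eq f'K | |].
  by rewrite -f_eq f'K f_turn; apply/eqP => bE; move: b2; rewrite bE /=; case: (f a).2.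
move=> c ca cta; have [c2|c2] := eqVneq (f c).2 (f a).2; first exact: side.
have a_ta : a != turn a.
  by rewrite -f_eq f_turn; case: (f a) => x []; rewrite xpair_eqE andbF.
have tc_a : turn c != a by rewrite (can2_eq turnK turnK).
have tc_ta : turn c != turn a by rewrite (can_eq turnK).
(* For [c] on the other copy, [c] and [turn c] are exchanged, which reduces to [side]. *)
have -> : (q' a (turn a) c == turn c) = (q' a (turn a) (turn c) == turn (turn c)).
  by rewrite turnK; apply/eqP/eqP => E; rewrite -{1}E (quadK q'P) // eq_sym.
rewrite side //; first by rewrite (can2_eq turnK turnK) (can_eq turnK) orbC.
by rewrite f_turn /=; move: c2; case: (f c).2; case: (f a).2.
Qed.

Theorem theorem9p7 (p u : nat) :
  prime p ->
  (p %% 12 = 7 \/ p \in [:: 37; 61; 73; 109; 157; 181; 229; 277]) ->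
  (u %% 24 = 8 \/ u %% 24 = 16) ->
  exists C : {set 'M[bool]_(u, 2 * p)},
    is_OOC_4_2 C /\ #|C| = Jstar u (2 * p).
Proof.
move=> p_prime p12 u24.
have p_gt4 : 4 < p.
  case: p12 => [|p_in]; first lia.
  by move: p p_in {p_prime}; apply/allP.
have co6p : coprime 6 p.
  rewrite coprime_sym prime_coprime //; apply/negP => p6.
  have := dvdn_leq (isT : 0 < 6) p6; move: p_prime p_gt4 p6 {p12}.
  by do 7?[case: p => [|p] //].
have u_gt0 : 0 < u by lia.
(* The odd part [m] of [u] is prime to 3; the base system takes [m * 4], and doublings supply the
   remaining power of 2. *)
have [m co2m uE] := pfactor_coprime (isT : prime 2) u_gt0.
have t_ge2 : 2 <= logn 2 u by rewrite -pfactor_dvdn //; lia.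
have co3u : coprime 3 u by rewrite prime_coprime //; lia.
have co3m : coprime 3 m by move: co3u; rewrite {1}uE coprimeMr => /andP[].
have /andP[co2p co3p] : coprime 2 p && coprime 3 p by rewrite -coprimeMl.
apply: code_of_row_system; rewrite // ?coprimeMr ?co3u //.
have -> : u = m * 4 * 2 ^ (logn 2 u - 2).
  by rewrite {1}uE -mulnA -[4]/(2 ^ 2) -expnD subnKC.
apply: row_system_exists; [lia | lia |].
by rewrite -[6]/(2 * 3) coprimeMl !coprimeMr co2m co2p co3m co3p.
Qed.
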